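(* Suppose that $(M,\check\nabla,\check\sigma)$ is a differentiable $B$-$A$ bimodule. Then the following defines a functor $(M,\check\nabla,\check\sigma)_*:{}_A\mathcal{E}\to{}_B\mathcal{E}$: on objects, $(M,\check\nabla,\check\sigma)_*(E,\nabla)=(M\otimes_AE,\hat\nabla)$, where $$\hat\nabla(m\otimes e)=\check\nabla m\otimes e+(\check\sigma\otimes\mathrm{id})(m\otimes\nabla e);$$ on morphisms $\phi:E\to F$, $(M,\check\nabla,\check\sigma)_*\phi=\mathrm{id}\otimes\phi:M\otimes_AE\to M\otimes_AF$.
   Context: Algebras are unital over a field $k$. A differential calculus on $A$ is a differential graded algebra $(\mathrm{d},\Omega^*A)$ with $\Omega^0A=A$; $A$ and $B$ are algebras with differential calculi. A connection on a left $A$-module $E$ is a linear map $\nabla:E\to\Omega^1A\otimes_AE$ with $\nabla(a.e)=\mathrm{d}a\otimes e+a\nabla e$. ${}_A\mathcal{E}$ is the category of left $A$-modules with connection; its morphisms are the left $A$-module maps $\phi$ with $\nabla\circ\phi=(\mathrm{id}\otimes\phi)\circ\nabla$. A differentiable $B$-$A$ bimodule is a $B$-$A$ bimodule $M$ with (a) a left $B$-connection $\check\nabla:M\to\Omega^1B\otimes_BM$ and (b) a $B$-$A$ bimodule map $\check\sigma:M\otimes_A\Omega^1A\to\Omega^1B\otimes_BM$, satisfying $\check\nabla(m.a)=\check\nabla(m).a+\check\sigma(m\otimes\mathrm{d}a)$ for all $m\in M$, $a\in A$. *)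

(* Defs.v *)
From HB Require Import structures.
From mathcomp Require Import all_boot all_algebra generic_quotient ring_quotient.
From mathcomp Require Import boolp.
From mathcomp.multinomials Require Import freeg.

Set Implicit Arguments.
Unset Strict Implicit.
Unset Printing Implicit Defensive.

Import GRing.Theory.
Local Open Scope ring_scope.
Local Open Scope quotient_scope.

(* A left module over a [k]-algebra is an [lmodType] over the underlying
   (noncommutative) ring; its [k]-vector space structure is restriction of
   scalars, c.x = c%:A *: x.  For a bimodule, [ract_alg] says that the
   [k]-structures coming from the two sides agree. *)
HB.mixin Record isBimodule (k : fieldType) (B A : algType k) M
    of GRing.Lmodule B M := {
  ract : M -> A -> M;
  ractDl : forall m m' a, ract (m + m') a = ract m a + ract m' a;
  ractDr : forall m a a', ract m (a + a') = ract m a + ract m a';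
  ractA : forall m a a', ract m (a * a') = ract (ract m a) a';
  ract1 : forall m, ract m 1 = m;
  ractZ : forall (b : B) m a, ract (b *: m) a = b *: ract m a;
  ract_alg : forall (c : k) m, ract m c%:A = (c%:A : B) *: m
}.

#[short(type="bimodType")]
HB.structure Definition Bimodule (k : fieldType) (B A : algType k) :=
  {M of isBimodule k B A M & GRing.Lmodule B M}.

Notation "m <* a" := (ract m a) (at level 40, left associativity).

Lemma ractB (k : fieldType) (B A : algType k) (M : bimodType B A) (a : A) :
  zmod_morphism ((@ract _ _ _ M)^~ a).
Proof.
move=> x y; apply: (addIr (y <* a)).
by rewrite -ractDl addrNK -addrA addNr addr0.
Qed.

Record bimodHom (k : fieldType) (B A : algType k) (M N : bimodType B A) :=
  BimodHom {
    bimodHom_linear :> {linear M -> N};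
    bimodHom_ract : forall m a,
      bimodHom_linear (m <* a) = bimodHom_linear m <* a
  }.

Definition bimodHom_id (k : fieldType) (B A : algType k) (M : bimodType B A) :
  bimodHom M M := @BimodHom k B A M M idfun (fun _ _ => erefl).

Lemma zmod_morphismD (U V : zmodType) (f : U -> V) :
  zmod_morphism f -> {morph f : x y / x + y}.
Proof.
move=> fB x y; have f0 : f 0 = 0 by rewrite -(subrr 0) fB subrr.
by rewrite -[y in LHS]opprK fB -[- y]sub0r fB f0 sub0r opprK.
Qed.

(* [tens M E] is the quotient of the free abelian group on M * E by the
   subgroup [tens_rel] generated by the biadditivity relations and
   (m.a, e) - (m, a.e). *)
Section TensorDef.
Variables (k : fieldType) (B A : algType k).
Variables (M : bimodType B A) (E : lmodType A).

Inductive tens_rel : {freeg (M * E) / int} -> Prop :=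
| tens_rel0 : tens_rel 0
| tens_relB x y of tens_rel x & tens_rel y : tens_rel (x - y)
| tens_relDl m m' e :
    tens_rel (<< (m + m', e) >> - (<< (m, e) >> + << (m', e) >>))
| tens_relDr m e e' :
    tens_rel (<< (m, e + e') >> - (<< (m, e) >> + << (m, e') >>))
| tens_relM m a e : tens_rel (<< (m <* a, e) >> - << (m, a *: e) >>).

Definition tens_null : {pred {freeg (M * E) / int}} :=
  fun x => `[< tens_rel x >].

Lemma tens_null_closed : zmod_closed tens_null.
Proof.
split; first by apply/asboolP; exact: tens_rel0.
by move=> x y /asboolP hx /asboolP hy; apply/asboolP; exact: tens_relB.
Qed.

HB.instance Definition _ := GRing.isZmodClosed.Build _ tens_null
  tens_null_closed.

Definition tens : Type := Quotient.quot tens_null.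

HB.instance Definition _ := GRing.Zmodule.on tens.

Definition tensor (m : M) (e : E) : tens :=
  \pi_(Quotient.quot tens_null) << (m, e) >>.

Lemma tens_pi0 x : tens_rel x -> \pi_(Quotient.quot tens_null) x = 0.
Proof.
move=> hx; have -> : 0 = \pi_(Quotient.quot tens_null) 0 by rewrite raddf0.
apply/eqP; rewrite -Quotient.idealrBE subr0; exact/asboolP.
Qed.

Lemma tensorDl m m' e : tensor (m + m') e = tensor m e + tensor m' e.
Proof.
apply/eqP; rewrite -subr_eq0 /tensor -raddfD -raddfB; apply/eqP.
exact/tens_pi0/tens_relDl.
Qed.

Lemma tensorDr m e e' : tensor m (e + e') = tensor m e + tensor m e'.
Proof.
apply/eqP; rewrite -subr_eq0 /tensor -raddfD -raddfB; apply/eqP.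
exact/tens_pi0/tens_relDr.
Qed.

Lemma tensorBl m m' e : tensor (m - m') e = tensor m e - tensor m' e.
Proof. by apply: (addIr (tensor m' e)); rewrite -tensorDl !addrNK. Qed.

Lemma tensorBr m e e' : tensor m (e - e') = tensor m e - tensor m e'.
Proof. by apply: (addIr (tensor m e')); rewrite -tensorDr !addrNK. Qed.

Lemma tensorM m a e : tensor (m <* a) e = tensor m (a *: e).
Proof.
apply/eqP; rewrite -subr_eq0 /tensor -raddfB; apply/eqP.
exact/tens_pi0/tens_relM.
Qed.

Lemma tens_ind (P : tens -> Prop) :
    (forall x y, P x -> P y -> P (x - y)) -> (forall m e, P (tensor m e)) ->
  forall t, P t.
Proof.
move=> PB PT; have P0 : P 0 by rewrite -(subrr (tensor 0 0)); exact: PB.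
have PN x : P x -> P (- x) by move=> Px; rewrite -sub0r; exact: PB.
have PD x y : P x -> P y -> P (x + y).
  by move=> Px Py; rewrite -(opprK y); apply: PB => //; exact: PN.
have PMn n x : P x -> P (x *+ n).
  by move=> Px; elim: n => [|n IH]; rewrite ?mulr0n // mulrS; exact: PD.
have PU (z : int) p : P (\pi_(Quotient.quot tens_null) << z *g p >>).
  have PUn n : P (\pi_(Quotient.quot tens_null) << n%:Z *g p >>).
    rewrite -[n%:Z]natz -freegU_muln raddfMn; apply: PMn.
    by case: p => m e; exact: PT.
  case: z => n; first exact: PUn.
  by rewrite NegzE -freegUN raddfN; apply/PN/PUn.
elim/quotW => D; rewrite -[D]freeg_sumE raddf_sum.
by apply: big_ind => // p _; exact: PU.
Qed.

Section Lift.
Variables (V : zmodType) (f : M -> E -> V).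

Definition balanced :=
  [/\ forall m m' e, f (m + m') e = f m e + f m' e,
      forall m e e', f m (e + e') = f m e + f m e' &
      forall m a e, f (m <* a) e = f m (a *: e)].

(* The additive map induced by [f] when [f] is balanced (see [tliftE]); the
   definition makes sense for any [f], but depends on the choice of
   representatives if [f] is not balanced. *)
Definition tlift (t : tens) : V :=
  fglift (fun p => f p.1 p.2 : zmodule V) (repr t).

Hypothesis f_bal : balanced.

Let L := fglift (fun p => f p.1 p.2 : zmodule V).

Let L_is_additive : zmod_morphism L.
Proof. exact: lift_is_additive. Qed.
HB.instance Definition _ := GRing.isZmodMorphism.Build _ _ L L_is_additive.

Let LU m e : L << (m, e) >> = f m e.
Proof. by rewrite /L liftU scale1r. Qed.

Let L_null x : tens_rel x -> L x = 0.
Proof.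
case: f_bal => fDl fDr fM.
elim=> {x} [|x y _ Lx _ Ly|m m' e|m e e'|m a e].
- exact: raddf0.
- by rewrite raddfB /= Lx Ly subrr.
- by rewrite raddfB raddfD /= !LU fDl subrr.
- by rewrite raddfB raddfD /= !LU fDr subrr.
- by rewrite raddfB /= !LU fM subrr.
Qed.

Let tlift_pi x : tlift (\pi_(Quotient.quot tens_null) x) = L x.
Proof.
apply/eqP; rewrite -subr_eq0 /tlift -/L -(raddfB L); apply/eqP/L_null.
have /eqP : repr (\pi_(Quotient.quot tens_null) x) = x
  %[mod Quotient.quot tens_null] by rewrite reprK.
by rewrite -Quotient.idealrBE => /asboolP.
Qed.

Lemma tliftE m e : tlift (tensor m e) = f m e.
Proof. by rewrite tlift_pi LU. Qed.

Lemma tlift_is_additive : zmod_morphism tlift.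
Proof.
elim/quotW => x; elim/quotW => y.
by rewrite -raddfB !tlift_pi raddfB.
Qed.

End Lift.

End TensorDef.

Lemma tens_ext (k : fieldType) (B A : algType k) (M : bimodType B A)
    (E : lmodType A) (V : zmodType) (f g : tens M E -> V) :
    zmod_morphism f -> zmod_morphism g ->
    (forall m e, f (tensor m e) = g (tensor m e)) ->
  f =1 g.
Proof.
move=> fB gB fg; apply: tens_ind => [x y fgx fgy|m e]; last exact: fg.
by rewrite fB gB fgx fgy.
Qed.

Section TensorLmodule.
Variables (k : fieldType) (B A : algType k).
Variables (M : bimodType B A) (E : lmodType A).

Definition tens_scale (b : B) : tens M E -> tens M E :=
  tlift (fun m e => tensor (b *: m) e).

Lemma tens_scale_balanced b :
  balanced (fun (m : M) (e : E) => tensor (b *: m) e).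
Proof.
split=> [m m' e|m e e'|m a e]; last by rewrite -ractZ tensorM.
- by rewrite scalerDr tensorDl.
- by rewrite tensorDr.
Qed.

Lemma tens_scaleE b m e : tens_scale b (tensor m e) = tensor (b *: m) e.
Proof. exact/tliftE/tens_scale_balanced. Qed.

Lemma tens_scaleB b : zmod_morphism (tens_scale b).
Proof. exact/tlift_is_additive/tens_scale_balanced. Qed.

Lemma tens_scaleA b c t : tens_scale b (tens_scale c t) = tens_scale (b * c) t.
Proof.
elim/tens_ind: t => [x y|m e]; first by rewrite !tens_scaleB => -> ->.
by rewrite !tens_scaleE scalerA.
Qed.

Lemma tens_scale1 : left_id 1 tens_scale.
Proof.
elim/tens_ind=> [x y|m e]; first by rewrite !tens_scaleB => -> ->.
by rewrite tens_scaleE scale1r.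
Qed.

Lemma tens_scaleDr : right_distributive tens_scale +%R.
Proof. by move=> b; exact/zmod_morphismD/tens_scaleB. Qed.

Lemma tens_scaleDl t : {morph tens_scale^~ t : b c / b + c}.
Proof.
move=> b c; elim/tens_ind: t => [x y|m e].
  by rewrite !tens_scaleB => -> ->; rewrite opprD addrACA.
by rewrite !tens_scaleE scalerDl tensorDl.
Qed.

HB.instance Definition _ := GRing.Zmodule_isLmodule.Build B (tens M E)
  tens_scaleA tens_scale1 tens_scaleDr tens_scaleDl.

Lemma tensorZ b m e : b *: tensor m e = tensor (b *: m) e.
Proof. exact: tens_scaleE. Qed.

End TensorLmodule.

(* [tens M E] as a left [B]-module. *)
Notation tensL := Defs_tens__canonical__GRing_Lmodule.

Section TensorBimodule.
Variables (k : fieldType) (C B A : algType k).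
Variables (N : bimodType C B) (M : bimodType B A).

Definition tens_ract (t : tens N M) (a : A) : tens N M :=
  tlift (fun n m => tensor n (m <* a)) t.

Lemma tens_ract_balanced a :
  balanced (fun (n : N) (m : M) => tensor n (m <* a)).
Proof.
split=> [n n' m|n m m'|n b m]; last by rewrite ractZ tensorM.
- by rewrite tensorDl.
- by rewrite ractDl tensorDr.
Qed.

Lemma tens_ractE n m a : tens_ract (tensor n m) a = tensor n (m <* a).
Proof. exact/(tliftE (f := fun n m => tensor n (m <* a)))/tens_ract_balanced. Qed.

Lemma tens_ractB a : zmod_morphism (tens_ract^~ a).
Proof. exact/tlift_is_additive/tens_ract_balanced. Qed.

Lemma tens_ractDl t t' a :
  tens_ract (t + t') a = tens_ract t a + tens_ract t' a.
Proof. exact: (zmod_morphismD (tens_ractB a)). Qed.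

Lemma tens_ractDr t a a' :
  tens_ract t (a + a') = tens_ract t a + tens_ract t a'.
Proof.
elim/tens_ind: t => [x y|n m].
  by rewrite !tens_ractB => -> ->; rewrite opprD addrACA.
by rewrite !tens_ractE ractDr tensorDr.
Qed.

Lemma tens_ractA t a a' : tens_ract t (a * a') = tens_ract (tens_ract t a) a'.
Proof.
elim/tens_ind: t => [x y|n m]; first by rewrite !tens_ractB => -> ->.
by rewrite !tens_ractE ractA.
Qed.

Lemma tens_ract1 t : tens_ract t 1 = t.
Proof.
elim/tens_ind: t => [x y|n m]; first by rewrite !tens_ractB => -> ->.
by rewrite !tens_ractE ract1.
Qed.

Lemma tens_ractZ (c : C) t a : tens_ract (c *: t) a = c *: tens_ract t a.
Proof.
elim/tens_ind: t => [x y|n m].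
  by rewrite !(tens_ractB, scalerBr) => -> ->.
by rewrite !(tensorZ, tens_ractE).
Qed.

Lemma tens_ract_alg (c : k) t : tens_ract t c%:A = (c%:A : C) *: t.
Proof.
elim/tens_ind: t => [x y|n m].
  by rewrite !(tens_ractB, scalerBr) => -> ->.
by rewrite tens_ractE ract_alg -tensorM ract_alg tensorZ.
Qed.

HB.instance Definition _ := isBimodule.Build k C A (tens N M)
  tens_ractDl tens_ractDr tens_ractA tens_ract1 tens_ractZ tens_ract_alg.

End TensorBimodule.

(* [tens N M] as a [C]-[A] bimodule: c.(n (x) m).a = (c.n) (x) (m.a). *)
Notation tensB := Defs_tens__canonical__Defs_Bimodule.

Lemma tensor_ract (k : fieldType) (C B A : algType k) (N : bimodType C B)
    (M : bimodType B A) n m (a : A) :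
  (tensor n m : tensB N M) <* a = tensor n (m <* a).
Proof. exact: tens_ractE. Qed.
Section TensorMap.
Variables (k : fieldType) (B A : algType k).
Variables (M M' : bimodType B A) (E E' : lmodType A).
Variables (f : bimodHom M M') (g : {linear E -> E'}).

Definition tens_map : tens M E -> tens M' E' :=
  tlift (fun m e => tensor (f m) (g e)).

Lemma tens_map_balanced : balanced (fun m e => tensor (f m) (g e)).
Proof.
split=> [m m' e|m e e'|m a e].
- by rewrite linearD tensorDl.
- by rewrite linearD tensorDr.
- by rewrite bimodHom_ract linearZ tensorM.
Qed.

Lemma tens_mapE m e : tens_map (tensor m e) = tensor (f m) (g e).
Proof. exact/tliftE/tens_map_balanced. Qed.

Lemma tens_map_is_additive : zmod_morphism tens_map.
Proof. exact/tlift_is_additive/tens_map_balanced. Qed.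

HB.instance Definition _ := GRing.isZmodMorphism.Build _ _ tens_map
  tens_map_is_additive.

Lemma tens_map_is_scalable : scalable tens_map.
Proof.
move=> b; elim/tens_ind => [x y|m e]; last first.
  by rewrite !(tensorZ, tens_mapE) linearZ.
by rewrite scalerBr !tens_map_is_additive scalerBr => -> ->.
Qed.

HB.instance Definition _ := GRing.isScalable.Build B _ _ _ tens_map
  tens_map_is_scalable.

End TensorMap.

Section TensorAssoc.
Variables (k : fieldType) (C B A : algType k).
Variables (N : bimodType C B) (M : bimodType B A) (E : lmodType A).

(* (n (x) m) (x) e |-> n (x) (m (x) e) *)
Definition tassoc : tens (tensB N M) E -> tens N (tensL M E) :=
  tlift (fun nm e => tlift (fun n m => tensor n (tensor m e)) nm).

(* n (x) (m (x) e) |-> (n (x) m) (x) e *)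
Definition tassocV : tens N (tensL M E) -> tens (tensB N M) E :=
  tlift (fun n me => tlift (fun m e => tensor (tensor n m) e) me).

Let bal2 (e : E) : balanced (fun (n : N) (m : M) => tensor n (tensor m e)).
Proof.
split=> [n n' m|n m m'|n b m]; first by rewrite tensorDl.
- by rewrite tensorDl tensorDr.
- by rewrite tensorM tensorZ.
Qed.

Let bal2V (n : N) :
  balanced (fun (m : M) (e : E) => tensor (tensor n m : tensB N M) e).
Proof.
split=> [m m' e|m e e'|m a e]; last by rewrite -tensorM tensor_ract.
- by rewrite tensorDr tensorDl.
- by rewrite tensorDr.
Qed.

Lemma tassoc_balanced :
  balanced (fun (nm : tensB N M) (e : E) =>
              tlift (fun n m => tensor n (tensor m e)) nm).
Proof.
have tB e := tlift_is_additive (bal2 e).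
split=> [x y e|t e e'|t a e].
- exact: (zmod_morphismD (tB e)).
- elim/tens_ind: t => [x y|n m]; first by rewrite !tB => -> ->; rewrite opprD addrACA.
  by rewrite !tliftE // !tensorDr.
- elim/tens_ind: t => [x y|n m].
    by rewrite ractB !tB => -> ->.
  by rewrite tensor_ract !tliftE // tensorM.
Qed.

Lemma tassocV_balanced :
  balanced (fun (n : N) (t : tensL M E) =>
              tlift (fun m e => tensor (tensor n m : tensB N M) e) t).
Proof.
have tB n := tlift_is_additive (bal2V n).
split=> [n n' t|n x y|n b t].
- elim/tens_ind: t => [x y|m e].
    by rewrite !tB => -> ->; rewrite opprD addrACA.
  by rewrite !tliftE // !tensorDl.
- exact: (zmod_morphismD (tB n)).
- elim/tens_ind: t => [x y|m e].
    by rewrite scalerBr !tB => -> ->.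
  by rewrite tensorZ !tliftE // tensorM.
Qed.

Lemma tassocE n m e :
  tassoc (tensor (tensor n m : tensB N M) e) = tensor n (tensor m e).
Proof. by rewrite /tassoc (tliftE tassoc_balanced) tliftE. Qed.

Lemma tassocVE n m e :
  tassocV (tensor n (tensor m e)) = tensor (tensor n m : tensB N M) e.
Proof. by rewrite /tassocV (tliftE tassocV_balanced) tliftE. Qed.

Lemma tassoc_is_additive : zmod_morphism tassoc.
Proof. exact/tlift_is_additive/tassoc_balanced. Qed.

Lemma tassocV_is_additive : zmod_morphism tassocV.
Proof. exact/tlift_is_additive/tassocV_balanced. Qed.

Lemma tassocK : cancel tassoc tassocV.
Proof.
apply: tens_ind => [x y hx hy|t e].
  by rewrite tassoc_is_additive tassocV_is_additive hx hy.
elim/tens_ind: t => [x y hx hy|n m]; last by rewrite tassocE tassocVE.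
by rewrite tensorBl tassoc_is_additive tassocV_is_additive hx hy.
Qed.

Lemma tassocVK : cancel tassocV tassoc.
Proof.
apply: tens_ind => [x y hx hy|n t].
  by rewrite tassocV_is_additive tassoc_is_additive hx hy.
elim/tens_ind: t => [x y hx hy|m e]; last by rewrite tassocVE tassocE.
by rewrite tensorBr tassocV_is_additive tassoc_is_additive hx hy.
Qed.

HB.instance Definition _ := GRing.isZmodMorphism.Build _ _ tassoc
  tassoc_is_additive.
HB.instance Definition _ := GRing.isZmodMorphism.Build _ _ tassocV
  tassocV_is_additive.

Lemma tassoc_is_scalable : scalable tassoc.
Proof.
move=> c; apply: tens_ind => [x y hx hy|t e].
  by rewrite scalerBr !raddfB /= hx hy.
rewrite tensorZ; elim/tens_ind: t => [x y hx hy|n m].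
  by rewrite scalerBr !tensorBl !raddfB /= hx hy.
by rewrite !(tensorZ, tassocE).
Qed.

Lemma tassocV_is_scalable : scalable tassocV.
Proof.
move=> c; apply: tens_ind => [x y hx hy|n t].
  by rewrite scalerBr !raddfB /= hx hy.
rewrite tensorZ; elim/tens_ind: t => [x y hx hy|m e].
  by rewrite !tensorBr !raddfB /= hx hy.
by rewrite !(tensorZ, tassocVE).
Qed.

HB.instance Definition _ := GRing.isScalable.Build C _ _ _ tassoc
  tassoc_is_scalable.
HB.instance Definition _ := GRing.isScalable.Build C _ _ _ tassocV
  tassocV_is_scalable.

End TensorAssoc.

(* Omega^0 A is A itself, and Omega^(n+1) A is [W n]. *)
Definition forms (k : fieldType) (A : algType k) (W : nat -> lmodType k)
  (n : nat) : lmodType k := if n is n'.+1 then W n' else A.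

Definition cast_deg (k : fieldType) (Om : nat -> lmodType k) (m n : nat)
  (e : m = n) (x : Om m) : Om n := ecast i (Om i) e x.

(* A differential graded algebra over [k] whose degree 0 part is the algebra
   [A]. *)
Record calculus (k : fieldType) (A : algType k) := Calculus {
  posforms : nat -> lmodType k;
  Omega := forms A posforms : nat -> lmodType k;
  wedge : forall m n, Omega m -> Omega n -> Omega (m + n)%N;
  ext_d : forall n, Omega n -> Omega n.+1;
  wedge_linearr : forall m n (x : Omega m), linear (@wedge m n x);
  wedge_linearl : forall m n (y : Omega n), linear ((@wedge m n)^~ y);
  wedge00 : forall a b : A, wedge (a : Omega 0) (b : Omega 0) = a * b;
  wedge1 : forall n (x : Omega n), wedge ((1 : A) : Omega 0) x = x;
  wedger1 : forall n (x : Omega n),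
    cast_deg (addn0 n) (wedge x ((1 : A) : Omega 0)) = x;
  wedgeA : forall m n p (x : Omega m) (y : Omega n) (z : Omega p),
    cast_deg (addnA m n p) (wedge x (wedge y z)) = wedge (wedge x y) z;
  ext_d_linear : forall n, linear (@ext_d n);
  ext_dd : forall n (x : Omega n), ext_d (ext_d x) = 0;
  ext_d_wedge : forall m n (x : Omega m) (y : Omega n),
    ext_d (wedge x y) = wedge (ext_d x) y
      + (-1) ^+ m *: cast_deg (addnS m n) (wedge x (ext_d y))
}.

Section Omega1.
Variables (k : fieldType) (A : algType k) (C : calculus A).

(* Omega^1 A as an [A]-bimodule, for the products Omega^0 x Omega^1 -> Omega^1
   and Omega^1 x Omega^0 -> Omega^1 of the calculus. *)
Definition Omega1 : Type := Omega C 1.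

HB.instance Definition _ := GRing.Zmodule.on Omega1.

Definition Omega1_scale (a : A) (w : Omega1) : Omega1 :=
  @wedge _ _ C 0 1 a w.

Definition Omega1_ract (w : Omega1) (a : A) : Omega1 :=
  @wedge _ _ C 1 0 w a.

Lemma cast_deg_id (Om : nat -> lmodType k) n (e : n = n) (x : Om n) :
  cast_deg e x = x.
Proof. by rewrite (eq_axiomK e). Qed.

Lemma Omega1_scaleA a b w :
  Omega1_scale a (Omega1_scale b w) = Omega1_scale (a * b) w.
Proof.
rewrite /Omega1_scale -(wedge00 C).
by rewrite -(@wedgeA _ _ C 0 0 1) cast_deg_id.
Qed.

Lemma Omega1_scale1 : left_id 1 Omega1_scale.
Proof. exact: wedge1. Qed.

Lemma Omega1_scaleDr : right_distributive Omega1_scale +%R.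
Proof.
move=> a v w; have := @wedge_linearr _ _ C 0 1 a 1 v w.
by rewrite !scale1r.
Qed.

Lemma Omega1_scaleDl w : {morph Omega1_scale^~ w : a b / a + b}.
Proof.
move=> a b; have := @wedge_linearl _ _ C 0 1 w 1 a b.
by rewrite !scale1r.
Qed.

HB.instance Definition _ := GRing.Zmodule_isLmodule.Build A Omega1
  Omega1_scaleA Omega1_scale1 Omega1_scaleDr Omega1_scaleDl.

Lemma Omega1_ractDl v w a :
  Omega1_ract (v + w) a = Omega1_ract v a + Omega1_ract w a.
Proof.
have := @wedge_linearl _ _ C 1 0 a 1 v w.
by rewrite !scale1r.
Qed.

Lemma Omega1_ractDr w a b :
  Omega1_ract w (a + b) = Omega1_ract w a + Omega1_ract w b.
Proof.
have := @wedge_linearr _ _ C 1 0 w 1 a b.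
by rewrite !scale1r.
Qed.

Lemma Omega1_ractA w a b :
  Omega1_ract w (a * b) = Omega1_ract (Omega1_ract w a) b.
Proof.
rewrite /Omega1_ract -(wedge00 C).
by rewrite -(@wedgeA _ _ C 1 0 0) cast_deg_id.
Qed.

Lemma Omega1_ract1 w : Omega1_ract w 1 = w.
Proof. by rewrite -[RHS](wedger1 w) cast_deg_id. Qed.

Lemma Omega1_ractZ (a : A) w b :
  Omega1_ract (a *: w) b = a *: Omega1_ract w b.
Proof.
by rewrite [RHS]/(@wedge _ _ C 0 1 a _) /Omega1_ract
  -(@wedgeA _ _ C 0 1 0) cast_deg_id.
Qed.

Lemma Omega1_ract_alg (c : k) (w : Omega1) :
  Omega1_ract w c%:A = (c%:A : A) *: w.
Proof.
have wr := GRing.scalable_linear (@wedge_linearr _ _ C 1 0 w) c (1 : A).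
have lw := GRing.scalable_linear (@wedge_linearl _ _ C 0 1 w) c (1 : A).
have w1 := Omega1_ract1 w; rewrite /Omega1_ract in w1.
rewrite w1 in wr; rewrite (@wedge1 _ _ C 1 w) in lw.
exact: etrans wr (esym lw).
Qed.

HB.instance Definition _ := isBimodule.Build k A A Omega1
  Omega1_ractDl Omega1_ractDr Omega1_ractA Omega1_ract1 Omega1_ractZ
  Omega1_ract_alg.

Definition ext_d0 (a : A) : Omega1 := @ext_d _ _ C 0 a.

End Omega1.

Notation bimodOmega1 := Defs_Omega1__canonical__Defs_Bimodule.

(* The first two clauses are [k]-linearity, [k] acting through c%:A. *)
Definition is_connection (k : fieldType) (A : algType k) (C : calculus A)
    (E : lmodType A) (nabla : E -> tens (bimodOmega1 C) E) : Prop :=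
  [/\ forall e e', nabla (e + e') = nabla e + nabla e',
      forall (c : k) e, nabla ((c%:A : A) *: e) = (c%:A : A) *: nabla e &
      forall a e, nabla (a *: e) = tensor (ext_d0 C a) e + a *: nabla e].

Record leftConn (k : fieldType) (A : algType k) (C : calculus A) := LeftConn {
  conn_mod :> lmodType A;
  conn_nabla : conn_mod -> tens (bimodOmega1 C) conn_mod;
  conn_nablaP : is_connection conn_nabla
}.

Record connHom (k : fieldType) (A : algType k) (C : calculus A)
    (E F : leftConn C) := ConnHom {
  connHom_linear :> {linear E -> F};
  connHomP : forall e, conn_nabla (connHom_linear e)
    = tens_map (bimodHom_id (bimodOmega1 C)) connHom_linear (conn_nabla e)
}.

Record diffBimod (k : fieldType) (A B : algType k)
    (CA : calculus A) (CB : calculus B) := DiffBimod {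
  diff_bimod :> bimodType B A;
  diff_nabla : diff_bimod -> tens (bimodOmega1 CB) diff_bimod;
  diff_nablaP : is_connection diff_nabla;
  diff_sigma : bimodHom (tensB diff_bimod (bimodOmega1 CA))
                        (tensB (bimodOmega1 CB) diff_bimod);
  diff_nabla_ract : forall m a,
    diff_nabla (m <* a)
      = (diff_nabla m : tensB (bimodOmega1 CB) diff_bimod) <* a
        + diff_sigma (tensor m (ext_d0 CA a))
}.

Record category := Category {
  cat_ob :> Type;
  cat_hom : cat_ob -> cat_ob -> Type;
  cat_id : forall X, cat_hom X X;
  cat_comp : forall X Y Z, cat_hom Y Z -> cat_hom X Y -> cat_hom X Z;
  cat_comp_idl : forall X Y (f : cat_hom X Y), cat_comp (cat_id Y) f = f;
  cat_comp_idr : forall X Y (f : cat_hom X Y), cat_comp f (cat_id X) = f;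
  cat_compA : forall X Y Z T (h : cat_hom Z T) (g : cat_hom Y Z) (f : cat_hom X Y),
    cat_comp h (cat_comp g f) = cat_comp (cat_comp h g) f
}.

Definition is_functor (C D : category) (F : C -> D)
    (Fm : forall X Y : C, cat_hom X Y -> cat_hom (F X) (F Y)) : Prop :=
  (forall X : C, Fm X X (cat_id X) = cat_id (F X)) /\
  (forall (X Y Z : C) (g : cat_hom Y Z) (f : cat_hom X Y),
     Fm X Z (cat_comp g f) = cat_comp (Fm Y Z g) (Fm X Y f)).

Section ConnCategory.
Variables (k : fieldType) (A : algType k) (C : calculus A).

Lemma linear_eq (U V : lmodType A) (f g : {linear U -> V}) :
  f =1 g -> f = g.
Proof.
case: f g => [f cf] [g cg] /= fg; have {}fg : f = g by apply/funext.
subst g; congr (GRing.Linear.Pack _).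
case: cf cg => [[a] [b]] [[a'] [b']].
by rewrite (Prop_irrelevance a a') (Prop_irrelevance b b').
Qed.

Lemma connHom_eq (E F : leftConn C) (phi psi : connHom E F) :
  phi =1 psi -> phi = psi.
Proof.
case: phi psi => [f fP] [g gP] /= /linear_eq fg.
by subst g; rewrite (Prop_irrelevance fP gP).
Qed.

Lemma connHom_idP (E : leftConn C) (e : E) :
  conn_nabla ((idfun : {linear E -> E}) e)
    = tens_map (bimodHom_id (bimodOmega1 C)) idfun (conn_nabla e).
Proof.
rewrite /=; elim/tens_ind: (conn_nabla e) => [x y hx hy|w x].
  by rewrite raddfB /= -hx -hy.
by rewrite tens_mapE.
Qed.

Definition connHom_id (E : leftConn C) : connHom E E :=
  ConnHom (@connHom_idP E).

Lemma connHom_compP (E F G : leftConn C) (psi : connHom F G)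
    (phi : connHom E F) (e : E) :
  conn_nabla ((psi \o phi : {linear E -> G}) e)
    = tens_map (bimodHom_id (bimodOmega1 C)) (psi \o phi) (conn_nabla e).
Proof.
rewrite /= !connHomP; elim/tens_ind: (conn_nabla e) => [x y hx hy|w x].
  by rewrite !raddfB /= hx hy.
by rewrite !tens_mapE.
Qed.

Definition connHom_comp (E F G : leftConn C) (psi : connHom F G)
  (phi : connHom E F) : connHom E G := ConnHom (connHom_compP psi phi).

Definition connCat : category.
Proof.
refine (@Category (leftConn C) (@connHom _ _ C) connHom_id connHom_comp _ _ _).
- by move=> E F f; apply: connHom_eq.
- by move=> E F f; apply: connHom_eq.
- by move=> E F G H h g f; apply: connHom_eq.
Defined.

End ConnCategory.

(* Main.v *)
Require Import Defs.
From HB Require Import structures.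
From mathcomp Require Import all_boot all_algebra.

(** On M (x) E the derivative has two parts, one differentiating m and one
    differentiating e.  The expressions nabla m (x) e and
    (sigma (x) id)(m (x) nabla e) are not separately well defined over A:
    moving a scalar a across the tensor sign creates, by the twisted right
    Leibniz rule of M, the term sigma(m (x) da) (x) e in the first, and, by
    the Leibniz rule of E, the same term in the second but on the other side
    of the sign.  The two defects cancel in the sum ([hat_balanced]), which
    therefore descends to an additive map on M (x) E.

    The left Leibniz rule over B ([hat_connection]) comes from that of M
    alone, as the second part is left B-linear.  For a connection-preserving
    phi, id (x) phi intertwines the two hat connections because the
    associativity isomorphism and sigma (x) id both commute with applying phi
    to the last factor ([twist_natural], [hat_natural]).  Functoriality of
    id (x) phi is then checked on elementary tensors. *)

Set Implicit Arguments.
Unset Strict Implicit.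
Unset Printing Implicit Defensive.

Import GRing.Theory.
Local Open Scope ring_scope.

Lemma tassoc_natural (k : fieldType) (C B A : algType k) (N : bimodType C B)
    (M : bimodType B A) (E F : lmodType A) (phi : {linear E -> F})
    (u : tensB N M) (e : E) :
  tens_map (bimodHom_id N) (tens_map (bimodHom_id M) phi) (tassoc (tensor u e))
    = tassoc (tensor u (phi e)).
Proof.
elim/tens_ind: u => [x y hx hy|n m].
  by rewrite !tensorBl !raddfB /= hx hy.
by rewrite !tassocE tens_mapE /= tens_mapE.
Qed.

Section InducedConnection.
Variables (k : fieldType) (A B : algType k).
Variables (CA : calculus A) (CB : calculus B) (M : diffBimod CA CB).

(** Keeping m and w apart in (sigma (x) id)(m (x) w) lets the balancing, the
    B-linearity and the naturality of this map be used for w = nabla e, although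
    nabla e is only Leibniz, not A-linear, in e. *)
Definition twist (E : lmodType A) (m : M) (w : tens (bimodOmega1 CA) E) :
    tens (bimodOmega1 CB) (tensL M E) :=
  tassoc (tens_map (diff_sigma M) (idfun : {linear E -> E})
            (tassocV (tensor m w))).

Lemma twistE (E : lmodType A) m (w : bimodOmega1 CA) (e : E) :
  twist m (tensor w e) = tassoc (tensor (diff_sigma M (tensor m w)) e).
Proof. by rewrite /twist tassocVE tens_mapE. Qed.

Lemma twistDl (E : lmodType A) m m' (w : tens (bimodOmega1 CA) E) :
  twist (m + m') w = twist m w + twist m' w.
Proof. by rewrite /twist tensorDl !raddfD. Qed.

Lemma twistDr (E : lmodType A) m (w w' : tens (bimodOmega1 CA) E) :
  twist m (w + w') = twist m w + twist m w'.
Proof. by rewrite /twist tensorDr !raddfD. Qed.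

Lemma twistBr (E : lmodType A) m (w w' : tens (bimodOmega1 CA) E) :
  twist m (w - w') = twist m w - twist m w'.
Proof. by rewrite /twist tensorBr !raddfB. Qed.

Lemma twistM (E : lmodType A) m a (w : tens (bimodOmega1 CA) E) :
  twist (m <* a) w = twist m (a *: w).
Proof. by rewrite /twist tensorM. Qed.

Lemma twistZ (E : lmodType A) (b : B) m (w : tens (bimodOmega1 CA) E) :
  twist (b *: m) w = b *: twist m w.
Proof. by rewrite /twist -tensorZ !linearZ. Qed.

Lemma twist_natural (E F : lmodType A) (phi : {linear E -> F}) m
    (w : tens (bimodOmega1 CA) E) :
  tens_map (bimodHom_id (bimodOmega1 CB)) (tens_map (bimodHom_id M) phi)
      (twist m w)
    = twist m (tens_map (bimodHom_id (bimodOmega1 CA)) phi w).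
Proof.
elim/tens_ind: w => [x y hx hy|w e].
  by rewrite raddfB !twistBr raddfB /= hx hy.
by rewrite tens_mapE !twistE tassoc_natural.
Qed.

Section OnModule.
Variable E : leftConn CA.

Definition hat_pre (m : M) (e : E) : tens (bimodOmega1 CB) (tensL M E) :=
  tassoc (tensor (diff_nabla m : tensB (bimodOmega1 CB) M) e)
    + twist m (conn_nabla e).

(** Both hat_pre (m.a) e and hat_pre m (a.e) equal
    nabla m (x) a.e + sigma(m (x) da) (x) e + (sigma (x) id)(m (x) a.nabla e);
    the middle term comes from M in the first and from E in the second. *)
Lemma hat_balanced : balanced hat_pre.
Proof.
have [nMD _ _] := diff_nablaP M; have [nED _ nEL] := conn_nablaP E.
split=> [m m' e|m e e'|m a e]; rewrite /hat_pre.
- by rewrite nMD tensorDl raddfD twistDl addrACA.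
- by rewrite nED tensorDr raddfD twistDr addrACA.
- by rewrite diff_nabla_ract nEL tensorDl raddfD tensorM twistDr twistE twistM
    addrA.
Qed.

Definition hat (t : tensL M E) : tens (bimodOmega1 CB) (tensL M E) :=
  tlift hat_pre t.

Lemma hatE m e : hat (tensor m e) = hat_pre m e.
Proof. exact/tliftE/hat_balanced. Qed.

Lemma hatB : zmod_morphism hat.
Proof. exact/tlift_is_additive/hat_balanced. Qed.

Lemma hat_connection : is_connection hat.
Proof.
have [_ nMZ nML] := diff_nablaP M.
split=> [|c|b]; first exact: (zmod_morphismD hatB).
- elim/tens_ind=> [x y hx hy|m e]; first by rewrite scalerBr !hatB hx hy scalerBr.
  by rewrite tensorZ !hatE /hat_pre nMZ -tensorZ twistZ linearZ scalerDr.
- elim/tens_ind=> [x y hx hy|m e].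
    by rewrite scalerBr !hatB hx hy tensorBr scalerBr opprD addrACA.
  rewrite tensorZ !hatE /hat_pre nML tensorDl raddfD -tensorZ /= tassocE.
  by rewrite twistZ linearZ scalerDr addrA.
Qed.

End OnModule.

Lemma hat_natural (E F : leftConn CA) (phi : connHom E F) (t : tensL M E) :
  hat (tens_map (bimodHom_id M) phi t)
    = tens_map (bimodHom_id (bimodOmega1 CB)) (tens_map (bimodHom_id M) phi)
        (hat t).
Proof.
elim/tens_ind: t => [x y hx hy|m e].
  by rewrite raddfB !hatB raddfB /= hx hy.
rewrite tens_mapE !hatE /hat_pre raddfD /=.
by rewrite tassoc_natural twist_natural connHomP.
Qed.

Definition induced_conn (E : leftConn CA) : leftConn CB :=
  LeftConn (hat_connection E).

Definition induced_hom (E F : leftConn CA) (phi : connHom E F) :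
    connHom (induced_conn E) (induced_conn F) :=
  @ConnHom _ _ _ (induced_conn E) (induced_conn F)
    (tens_map (bimodHom_id M) phi) (hat_natural phi).

Lemma induced_hom_id (E : leftConn CA) :
  induced_hom (connHom_id E) = connHom_id (induced_conn E).
Proof.
apply: connHom_eq => /=; apply: tens_ext => [x y|//|m e]; last by rewrite tens_mapE.
exact: raddfB.
Qed.

Lemma induced_hom_comp (E F G : leftConn CA) (psi : connHom F G)
    (phi : connHom E F) :
  induced_hom (connHom_comp psi phi)
    = connHom_comp (induced_hom psi) (induced_hom phi).
Proof.
apply: connHom_eq => /=; apply: tens_ext => [x y|x y|m e].
- exact: raddfB.
- by rewrite /= !raddfB.
- by rewrite /= !tens_mapE.
Qed.

End InducedConnection.

Theorem proposition2p12 (k : fieldType) (A B : algType k)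
    (CA : calculus A) (CB : calculus B) (M : diffBimod CA CB) :
  exists nabla_hat : forall E : leftConn CA,
      tensL M E -> tens (bimodOmega1 CB) (tensL M E),
    [/\ forall (E : leftConn CA) (m : M) (e : E),
          nabla_hat E (tensor m e)
            = tassoc (tensor (diff_nabla m : tensB (bimodOmega1 CB) M) e)
              + tassoc (tens_map (diff_sigma M) (idfun : {linear E -> E})
                          (tassocV (tensor m (conn_nabla e)))),
        forall (E : leftConn CA)
            (f : tensL M E -> tens (bimodOmega1 CB) (tensL M E)),
          zmod_morphism f ->
          (forall (m : M) (e : E), f (tensor m e) = nabla_hat E (tensor m e)) ->
          f =1 nabla_hat E &
        exists nabla_hatP : forall E : leftConn CA, is_connection (nabla_hat E),
        let Fob : connCat CA -> connCat CB :=
          fun E => LeftConn (nabla_hatP E) in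
        exists Fmor : forall E F : connCat CA,
            cat_hom E F -> cat_hom (Fob E) (Fob F),
          (forall (E F : leftConn CA) (phi : connHom E F) (t : tensL M E),
             (Fmor E F phi : connHom (Fob E : leftConn CB) (Fob F)) t
               = tens_map (bimodHom_id M) phi t) /\
          is_functor Fmor].
Proof.
exists (@hat _ _ _ _ _ M); split=> [E m e|E f fB fE|].
- exact: hatE.
- exact: tens_ext fB (@hatB _ _ _ _ _ M E) fE.
exists (@hat_connection _ _ _ _ _ M); exists (@induced_hom _ _ _ _ _ M).
split=> //; split=> [E|E F G psi phi].
- exact: induced_hom_id.
- exact: induced_hom_comp.
Qed.
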